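(* There is a $2$-c.e. set $C\subseteq\omega$ which has an asymptotic density but whose density $\rho(C)$ is not the asymptotic density of any c.e. set or of any co-c.e. set.
   Context: For $X \subseteq \omega=\{0,1,2,\dots\}$ and an integer $m>0$, let $\rho_m(X) = |\{j \in X : j < m\}|/m$. The set $X$ has a (asymptotic) density if $\lim_m \rho_m(X)$ exists, and the density is then $\rho(X) = \lim_m \rho_m(X)$. Sets are identified with their characteristic functions. A set $C \subseteq \omega$ is $2$-c.e. if there is a computable function $g:\omega\times\omega\to\{0,1\}$ such that for all $x$: $g(x,0)=0$, $C(x)=\lim_s g(x,s)$, and $|\{s : g(x,s) \neq g(x,s+1)\}| \leq 2$. Equivalently, $C$ is a difference $A\setminus B$ of two c.e. sets. A set is co-c.e. if its complement in $\omega$ is c.e. *)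

(* Defs.v *)
From mathcomp Require Import all_boot all_order all_algebra.
From mathcomp Require Import boolp classical_sets functions cardinality.
From mathcomp Require Import reals topology normedtype sequences.

Set Implicit Arguments.
Unset Strict Implicit.
Unset Printing Implicit Defensive.

Import GRing.Theory numFieldNormedType.Exports.

Local Open Scope classical_set_scope.
Local Open Scope nat_scope.

(** * Partial computable functions (Kleene's mu-recursive functions) *)

(* A partial function nat^n -> nat, given by its graph. *)
Definition pfunction (n : nat) := n.-tuple nat -> nat -> Prop.

Definition pf_comp m n (F : pfunction m) (G : 'I_m -> pfunction n) :
    pfunction n :=
  fun v y => exists w : m.-tuple nat, (forall i, G i v (tnth w i)) /\ F w y.

(* h (0, v) = F v  and  h (k + 1, v) = G (k, h (k, v), v) *)
Fixpoint pf_iter n (F : pfunction n) (G : pfunction n.+2) (k : nat)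
    (v : n.-tuple nat) (y : nat) : Prop :=
  match k with
  | 0 => F v y
  | k'.+1 => exists z, pf_iter F G k' v z /\ G [tuple of k' :: z :: v] y
  end.

Definition pf_prec n (F : pfunction n) (G : pfunction n.+2) :
    pfunction n.+1 :=
  fun v y => pf_iter F G (thead v) (behead_tuple v) y.

(* Unbounded search diverges as soon as [F (z, v)] diverges for some [z] below
   the first zero. *)
Definition pf_mu n (F : pfunction n.+1) : pfunction n :=
  fun v y => F [tuple of y :: v] 0 /\
    forall z, z < y -> exists k, F [tuple of z :: v] k.+1.

Inductive mu_code : nat -> Type :=
| Zero n : mu_code n
| Succ : mu_code 1
| Proj n (i : 'I_n) : mu_code n
| Comp m n (f : mu_code m) (g : 'I_m -> mu_code n) : mu_code n
| Prec n (f : mu_code n) (g : mu_code n.+2) : mu_code n.+1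
| Mu n (f : mu_code n.+1) : mu_code n.

Fixpoint mu_eval n (c : mu_code n) : pfunction n :=
  match c in mu_code n return pfunction n with
  | Zero _ => fun _ y => y = 0
  | Succ => fun v y => y = (thead v).+1
  | Proj _ i => fun v y => y = tnth v i
  | Comp _ _ f g => pf_comp (mu_eval f) (fun i => mu_eval (g i))
  | Prec _ f g => pf_prec (mu_eval f) (mu_eval g)
  | Mu _ f => pf_mu (mu_eval f)
  end.

Definition computable2 (g : nat -> nat -> nat) : Prop :=
  exists c : mu_code 2, forall x s, mu_eval c [tuple x; s] (g x s).

(** * Computably enumerable, co-c.e. and 2-c.e. sets *)

(* The domain of a partial computable function. *)
Definition ce (A : set nat) : Prop :=
  exists c : mu_code 1, A = [set x | exists y, mu_eval c [tuple x] y].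

Definition coce (A : set nat) : Prop := ce (~` A).

Definition two_ce (C : set nat) : Prop :=
  exists g : nat -> nat -> bool,
    [/\ computable2 (fun x s => nat_of_bool (g x s)),
        forall x, g x 0 = false,
        forall x, \forall s \near \oo, g x s = (x \in C)
      & forall x, ([set s | g x s != g x s.+1] #<= `I_2)%card].

(** * Asymptotic density *)

Local Open Scope ring_scope.

(* The value at [m = 0] is the junk value [0 / 0 = 0]; it does not affect the
   limit. *)
Definition rho (R : realType) (X : set nat) (m : nat) : R :=
  #|[pred j : 'I_m | (j : nat) \in X]|%:R / m%:R.

Definition has_density (R : realType) (X : set nat) : Prop :=
  cvgn (@rho R X).

Definition density (R : realType) (X : set nat) : R := limn (@rho R X).

(* Main.v *)
Require Import Defs.
From mathcomp Require Import all_boot all_order all_algebra zify lra.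
From mathcomp Require Import boolp classical_sets functions cardinality.
From mathcomp Require Import reals interval_inference topology normedtype.
From mathcomp Require Import sequences.

(* Densities are controlled bit by bit: split the natural numbers into regions
   [R_j] of density [2 ^- j.+1] and let [C] contain, up to finitely many
   elements, either all or nothing of each region; then the density of [C] is the
   sum of [2 ^- j.+1] over the regions taken.
   The decisions are made along the true path of a binary tree. Node [i] is in charge of one c.e. set [W] and one rational [q]: the
   statement that the density of [W] is at most [q], expressed as [rho_m W <= q]
   for all large [m], is Sigma_2, so it fails iff a computable sequence of ticks is
   infinite. The true path turns left at [i] when there are infinitely many ticks,
   right otherwise. A region attached to [j] is filled each time [j] is visited
   and emptied each time the approximated path passes to the left of [j]. Each
   number changes at most twice, and the region ends up full iff [j] is on the
   true path. Giving a region only to one child of [i] (the right one when [W]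
   itself is to be defeated, the left one for its complement) and choosing [q] in
   the gap between the contribution of that region and that of all later ones
   puts the density of [C] on the side of [q] opposite to the density of [W], or
   of its complement.
   A universal enumeration of the c.e. sets is obtained by coding the big-step
   semantics of mu-recursive codes as inference rules between numbers and
   iterating them on finite sets of numbers, represented by their bits. *)

Set Implicit Arguments.
Unset Strict Implicit.
Unset Printing Implicit Defensive.

Import Order.TTheory GRing.Theory Num.Theory numFieldNormedType.Exports.

Local Open Scope nat_scope.

(** * Total functions computed by mu-recursive codes *)

Definition representable n (f : n.-tuple nat -> nat) :=
  exists c : mu_code n, forall v, mu_eval c v (f v).

Lemma representable_ext n (f g : n.-tuple nat -> nat) :
  f =1 g -> representable f -> representable g.
Proof. by move=> fg [c cP]; exists c => v; rewrite -fg. Qed.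

Lemma representable_comp m n (f : m.-tuple nat -> nat)
    (g : 'I_m -> n.-tuple nat -> nat) :
  representable f -> (forall i, representable (g i)) ->
  representable (fun v => f [tuple g i v | i < m]).
Proof.
move=> [cf fP] /choice[cg gP]; exists (Comp cf cg) => v.
by exists [tuple g i v | i < m]; split=> // i; rewrite tnth_mktuple.
Qed.

Lemma representable_proj n (i : 'I_n) : representable (fun v => tnth v i).
Proof. by exists (Proj i). Qed.

Lemma representable_succ n (f : n.-tuple nat -> nat) :
  representable f -> representable (fun v => (f v).+1).
Proof.
move=> fP; apply: (@representable_ext _ (fun v =>
  (thead [tuple (fun=> f) i v | i < 1]).+1)).
  by move=> v; rewrite /thead tnth_mktuple.
by apply: (@representable_comp 1 n (fun w => (thead w).+1)) => //; exists Succ.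
Qed.

Lemma representable_rec n (b z : n.-tuple nat -> nat)
    (g : n.+2.-tuple nat -> nat) :
  representable b -> representable z -> representable g ->
  representable (fun v =>
    iteri (b v) (fun k a => g [tuple of k :: a :: v]) (z v)).
Proof.
move=> bP [cz zP] [cg gP].
pose h (w : n.+1.-tuple nat) := iteri (thead w)
  (fun k a => g [tuple of k :: a :: behead_tuple w]) (z (behead_tuple w)).
have hP : representable h.
  exists (Prec cz cg) => w; rewrite /h /= /pf_prec.
  elim: (thead w) => [|k IHk] /=; first exact: zP.
  by eexists; split; [exact: IHk | exact: gP].
(* [p] prepends the bound [b v], the argument on which [Prec] recurses, to [v]. *)
pose p (i : 'I_n.+1) (v : n.-tuple nat) :=
  if unlift ord0 i is Some j then tnth v j else b v.
apply: (@representable_ext _ (fun v => h [tuple p i v | i < n.+1])).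
  move=> v; rewrite /h /thead tnth_mktuple /p unlift_none.
  suff -> : behead_tuple [tuple p i v | i < n.+1] = v by [].
  apply: eq_from_tnth => j; rewrite tnth_behead tnth_mktuple /p.
  suff -> : inord j.+1 = lift ord0 j by rewrite liftK.
  by apply: val_inj; rewrite /= inordK ?ltnS.
apply: representable_comp => // i; rewrite /p.
by case: unlift => [j|] //; exact: representable_proj.
Qed.

(** * A language of primitive recursive terms *)

(* Variables are de Bruijn indices into a list of values; absent ones are [0].
   [Rec b z e] and [Sum b e] bind in [e] the index, preceding (for [Rec]) the
   accumulator. The body of a [Call] sees only the three arguments. *)
Inductive term :=
| Var (i : nat)
| Zer
| Suc (a : term)
| Rec (b z e : term)
| Sum (b e : term)
| Call (f a b c : term).

Fixpoint eval (e : term) (v : seq nat) : nat :=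
  match e with
  | Var i => nth 0 v i
  | Zer => 0
  | Suc a => (eval a v).+1
  | Rec b z e => iteri (eval b v) (fun k a => eval e (k :: a :: v)) (eval z v)
  | Sum b e => \sum_(k < eval b v) eval e ((k : nat) :: v)
  | Call f a b c => eval f [:: eval a v; eval b v; eval c v]
  end.

Lemma eval_representable e n : representable (fun v : n.-tuple nat => eval e v).
Proof.
have zeroP m : representable (fun _ : m.-tuple nat => 0) by exists (Zero m).
elim: e n => /=.
- move=> i n; have [lt_in|le_ni] := ltnP i n.
    apply: representable_ext (representable_proj (Ordinal lt_in)) => v.
    by rewrite (tnth_nth 0).
  apply: representable_ext (zeroP n) => v.
  by rewrite nth_default ?size_tuple.
- exact: zeroP.
- by move=> a IHa n; apply: representable_succ.
- move=> b IHb z IHz e IHe n.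
  exact: (representable_rec (IHb n) (IHz n) (IHe n.+2)).
- move=> b IHb e IHe n.
  have addP m (f g : m.-tuple nat -> nat) : representable f ->
      representable g -> representable (fun v => f v + g v).
    move=> fP gP; have sP : representable (fun w : m.+2.-tuple nat =>
      (tnth w (lift ord0 ord0)).+1).
      exact/representable_succ/representable_proj.
    apply: representable_ext (representable_rec fP gP sP) => v.
    by elim: (f v) => //= k ->.
  (* A sum is a recursion whose accumulator sits at index 1; [skip] steers the variables of [e]
     around that slot. *)
  pose skip (i : 'I_n.+1) : 'I_n.+2 :=
    if unlift ord0 i is Some j then lift ord0 (lift ord0 j) else ord0.
  pose body (w : n.+2.-tuple nat) :=
    eval e [tuple tnth w (skip i) | i < n.+1] + tnth w (lift ord0 ord0).
  have bodyP : representable body.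
    apply: addP; last exact: representable_proj.
    apply: (@representable_comp _ _ (fun v => eval e v)) => // i.
    exact: representable_proj.
  apply: representable_ext (representable_rec (IHb n) (zeroP n) bodyP) => v.
  elim: (eval b v) => [|k IHk]; first by rewrite big_ord0.
  rewrite big_ord_recr /= -IHk /= {1}/body [LHS]addnC; congr (_ + eval e _).
  rewrite -[RHS]/(tval [tuple of k :: v]); congr tval.
  apply: eq_from_tnth => i; rewrite tnth_mktuple /skip.
  by case: unliftP => [j ->|->] //; rewrite !tnthS.
- move=> f IHf a IHa b IHb c IHc n.
  pose arg (i : 'I_3) (v : n.-tuple nat) := eval (nth Zer [:: a; b; c] i) v.
  apply: (@representable_ext _ (fun v => eval f [tuple arg i v | i < 3])).
    move=> v; rewrite /= /arg; congr eval.
    rewrite enum_ordSl /= enum_ordSl /= enum_ordSl /=.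
    by rewrite (size0nil (size_enum_ord 0)).
  apply: (@representable_comp _ _ (fun v => eval f v)) => // i.
  by case: i => [[|[|[|]]]].
Qed.

Arguments eval : simpl never.

(** Truth is positivity, so that [Add] is disjunction, [Mul] conjunction and [Sum] bounded
    existence. *)
Definition holds (a : term) (v : seq nat) : bool := 0 < eval a v.

Fixpoint Cst n := if n is m.+1 then Suc (Cst m) else Zer.
Definition Add a b := Rec b a (Suc (Var 1)).
Definition Sub a b := Rec b a (Rec (Var 1) Zer (Var 0)).
(** [Call] gives both factors fixed indices, so that [a] needs no shifting under the binders of
    [Rec]. *)
Definition Mul a b := Call (Rec (Var 1) Zer (Add (Var 1) (Var 2))) a b Zer.
Definition Pow2 a := Rec a (Cst 1) (Add (Var 1) (Var 1)).
(** Uses that half of [k.+1] is [k] minus half of [k]. *)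
Definition Half a := Rec a Zer (Sub (Var 0) (Var 1)).
Definition Shr a t := Rec t a (Half (Var 1)).
Definition Neg a := Sub (Cst 1) a.
Definition Odd a := Sub a (Add (Half a) (Half a)).
Definition Leq a b := Neg (Sub a b).
Definition Ltn a b := Leq (Suc a) b.
Definition Eqn a b := Mul (Leq a b) (Leq b a).
Definition Bool a := Neg (Neg a).
Definition All b e := Neg (Sum b (Neg e)).

Section Evaluation.
Implicit Types (a b e t : term) (v : seq nat).

Lemma eval_Var i v : eval (Var i) v = nth 0 v i. Proof. by []. Qed.
Lemma eval_Zer v : eval Zer v = 0. Proof. by []. Qed.
Lemma eval_Suc a v : eval (Suc a) v = (eval a v).+1. Proof. by []. Qed.
Lemma eval_Call f a b c v :
  eval (Call f a b c) v = eval f [:: eval a v; eval b v; eval c v].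
Proof. by []. Qed.
Lemma eval_Rec b z e v : eval (Rec b z e) v =
  iteri (eval b v) (fun k x => eval e (k :: x :: v)) (eval z v).
Proof. by []. Qed.
Lemma eval_Sum b e v :
  eval (Sum b e) v = \sum_(k < eval b v) eval e ((k : nat) :: v).
Proof. by []. Qed.

Lemma eval_Cst n v : eval (Cst n) v = n.
Proof. by elim: n => //= n IHn; rewrite eval_Suc IHn. Qed.

Lemma eval_Add a b v : eval (Add a b) v = eval a v + eval b v.
Proof.
rewrite eval_Rec; elim: (eval b v) => [|k /= IHk]; first by rewrite addn0.
by rewrite addnS -IHk.
Qed.

Lemma eval_Sub a b v : eval (Sub a b) v = eval a v - eval b v.
Proof.
rewrite eval_Rec; elim: (eval b v) => [|k /= ->]; first by rewrite subn0.
by rewrite eval_Rec !eval_Var /= subnS; case: (_ - _).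
Qed.

Lemma eval_Mul a b v : eval (Mul a b) v = eval a v * eval b v.
Proof.
rewrite eval_Call eval_Rec eval_Var /=.
set w := [:: _; _; _]; have w0 : nth 0 w 0 = eval a v by [].
elim: (eval b v) w w0 => [|k IHk] w w0 /=; first by rewrite muln0.
by rewrite IHk // eval_Add !eval_Var /= w0 mulnS addnC.
Qed.

Lemma eval_Pow2 a v : eval (Pow2 a) v = 2 ^ eval a v.
Proof.
rewrite eval_Rec eval_Cst; elim: (eval a v) => [|k /= ->] //.
by rewrite eval_Add !eval_Var /= addnn -mul2n expnS.
Qed.

Lemma eval_Half a v : eval (Half a) v = (eval a v)./2.
Proof.
rewrite eval_Rec; elim: (eval a v) => [|k /= ->] //.
rewrite eval_Sub !eval_Var /=; lia.
Qed.

Lemma eval_Shr a t v : eval (Shr a t) v = eval a v %/ 2 ^ eval t v.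
Proof.
rewrite eval_Rec; elim: (eval t v) => [|k /= ->]; first by rewrite divn1.
by rewrite eval_Half eval_Var /= -divn2 -divnMA expnSr.
Qed.

Lemma holds_Neg a v : holds (Neg a) v = ~~ holds a v.
Proof. by rewrite /holds eval_Sub eval_Cst subn_gt0 ltnS leqn0 lt0n negbK. Qed.

Lemma holds_Odd a v : holds (Odd a) v = odd (eval a v).
Proof. by rewrite /holds eval_Sub eval_Add eval_Half; lia. Qed.

Lemma holds_Leq a b v : holds (Leq a b) v = (eval a v <= eval b v).
Proof. by rewrite holds_Neg /holds eval_Sub subn_gt0 -leqNgt. Qed.

Lemma holds_Ltn a b v : holds (Ltn a b) v = (eval a v < eval b v).
Proof. exact: holds_Leq. Qed.

Lemma holds_Mul a b v : holds (Mul a b) v = holds a v && holds b v.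
Proof. by rewrite /holds eval_Mul muln_gt0. Qed.

Lemma holds_Add a b v : holds (Add a b) v = holds a v || holds b v.
Proof. by rewrite /holds eval_Add addn_gt0. Qed.

Lemma holds_Eqn a b v : holds (Eqn a b) v = (eval a v == eval b v).
Proof. by rewrite holds_Mul !holds_Leq eqn_leq. Qed.

Lemma holds_Sum b e v :
  reflect (exists2 k, k < eval b v & holds e (k :: v)) (holds (Sum b e) v).
Proof.
rewrite /holds eval_Sum lt0n sum_nat_eq0 negb_forall; apply: (iffP existsP).
  by case=> k; rewrite -lt0n; exists k.
by case=> k lt_kb ek; exists (Ordinal lt_kb); rewrite -lt0n.
Qed.

Lemma holds_All b e v :
  reflect (forall k, k < eval b v -> holds e (k :: v)) (holds (All b e) v).
Proof.
rewrite holds_Neg; apply: (iffP negP) => [nex k lt_kb|all_e].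
  by apply/negPn/negP => nek; apply/nex/holds_Sum; exists k; rewrite ?holds_Neg.
by case/holds_Sum=> k /all_e; rewrite holds_Neg => ->.
Qed.

Lemma eval_Neg a v : eval (Neg a) v = ~~ holds a v.
Proof. by rewrite eval_Sub eval_Cst /holds; case: (eval a v). Qed.

Lemma eval_Bool a v : eval (Bool a) v = holds a v.
Proof. by rewrite eval_Neg holds_Neg negbK. Qed.

Lemma eval_Leq a b v : eval (Leq a b) v = (eval a v <= eval b v).
Proof. by rewrite eval_Neg -holds_Neg holds_Leq. Qed.

Lemma holds_Call f a b c v :
  holds (Call f a b c) v = holds f [:: eval a v; eval b v; eval c v].
Proof. by []. Qed.

End Evaluation.

Definition evalE := (eval_Var, eval_Zer, eval_Suc, eval_Call, eval_Cst,
  eval_Add, eval_Sub, eval_Mul, eval_Pow2, eval_Half, eval_Shr).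

(** * A universal enumeration *)

Definition pair x y := (x + y) * (x + y) + x.

(** With [s = x + y], the pair lies in the interval from [s ^ 2] to [s.+1 ^ 2], excluded; hence it
    determines [s], then [x]. *)
Lemma pair_inj x y x' y' : pair x y = pair x' y' -> x = x' /\ y = y'.
Proof.
rewrite /pair => eq_p; suff : x + y = x' + y' by lia.
have [lt_s|lt_s|//] := ltngtP (x + y) (x' + y').
- have := leq_mul lt_s lt_s; lia.
- have := leq_mul lt_s lt_s; lia.
Qed.

Definition Pair a b :=
  Call (Add (Mul (Add (Var 0) (Var 1)) (Add (Var 0) (Var 1))) (Var 0)) a b Zer.

Lemma eval_Pair a b v : eval (Pair a b) v = pair (eval a v) (eval b v).
Proof. by rewrite !evalE. Qed.

Definition mk t a b := pair t (pair a b).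
Definition Mk t a b := Pair (Cst t) (Pair a b).

Lemma eval_Mk t a b v : eval (Mk t a b) v = mk t (eval a v) (eval b v).
Proof. by rewrite !eval_Pair eval_Cst. Qed.

Definition fact c v y := pair c (pair v y).
Definition Fact c v y := Pair c (Pair v y).

Lemma eval_Fact c v y w :
  eval (Fact c v y) w = fact (eval c w) (eval v w) (eval y w).
Proof. by rewrite !eval_Pair. Qed.

Lemma fact_inj c v y c' v' y' :
  fact c v y = fact c' v' y' -> [/\ c = c', v = v' & y = y'].
Proof. by case/pair_inj=> -> /pair_inj[-> ->]. Qed.

Lemma mk_inj t a b t' a' b' :
  mk t a b = mk t' a' b' -> [/\ t = t', a = a' & b = b'].
Proof. exact: fact_inj. Qed.

Definition bit d i := odd (d %/ 2 ^ i).
Definition Bit d i := Odd (Shr d i).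

Lemma holds_Bit d i v : holds (Bit d i) v = bit (eval d v) (eval i v).
Proof. by rewrite holds_Odd eval_Shr. Qed.

Lemma bit0 i : bit 0 i = false.
Proof. by rewrite /bit div0n. Qed.

Lemma bit_sum (p : pred nat) n i :
  bit (\sum_(j < n) 2 ^ j * p j) i = (i < n) && p i.
Proof.
have small m : \sum_(j < m) 2 ^ j * p j < 2 ^ m.
  elim: m => [|m IHm]; first by rewrite big_ord0.
  rewrite big_ord_recr /= expnS mul2n -addnn -addSn leq_add //.
  by case: (p m); rewrite ?muln1 ?muln0.
elim: n => [|n IHn]; first by rewrite big_ord0 bit0.
rewrite big_ord_recr /= ltnS leq_eqVlt; have [->|ne_in] /= := eqVneq i n.
  rewrite /bit addnC mulnC divnMDl ?expn_gt0 //.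
  by rewrite (divn_small (small n)) addn0 oddb.
have [lt_in|le_ni] := ltnP i n.
  have -> : 2 ^ n * p n = (2 * (2 ^ (n - i.+1) * p n)) * 2 ^ i.
    by rewrite -[X in 2 ^ X * _](subnKC lt_in) expnD expnS; lia.
  rewrite /bit addnC divnMDl ?expn_gt0 // oddD oddM /=.
  by rewrite -/(bit _ i) IHn lt_in.
have := small n.+1; rewrite big_ord_recr /= => small_n.
rewrite /bit divn_small // (leq_trans small_n) // leq_exp2l //.
by rewrite ltn_neqAle eq_sym ne_in.
Qed.

(* Each rule is a conclusion with its premises, over the variables
   [z, y, v, x, g, f]. Codes are tagged [0] zero (also the empty vector),
   [1] successor, [2] projection, [3] cons on vectors of codes, [4] composition,
   [5] primitive recursion, [6] minimization, and [7] the search that computes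
   a minimization from a given lower bound. *)
Definition rules : seq (term * seq term) :=
  let z := Var 0 in let y := Var 1 in let v := Var 2 in
  let x := Var 3 in let g := Var 4 in let f := Var 5 in
  [:: (Fact (Mk 0 Zer Zer) v Zer, [::]);
      (Fact (Mk 1 Zer Zer) (Pair x v) (Suc x), [::]);
      (Fact (Mk 2 Zer Zer) (Pair x v) x, [::]);
      (Fact (Mk 2 (Suc z) Zer) (Pair x v) y, [:: Fact (Mk 2 z Zer) v y]);
      (Fact (Mk 3 f g) v (Pair y z), [:: Fact f v y; Fact g v z]);
      (Fact (Mk 4 f g) v y, [:: Fact g v z; Fact f z y]);
      (Fact (Mk 5 f g) (Pair Zer v) y, [:: Fact f v y]);
      (Fact (Mk 5 f g) (Pair (Suc x) v) y,
        [:: Fact (Mk 5 f g) (Pair x v) z; Fact g (Pair x (Pair z v)) y]);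
      (Fact (Mk 6 f Zer) v y, [:: Fact (Mk 7 f Zer) (Pair Zer v) y]);
      (Fact (Mk 7 f Zer) (Pair x v) x, [:: Fact f (Pair x v) Zer]);
      (Fact (Mk 7 f Zer) (Pair x v) y,
        [:: Fact f (Pair x v) (Suc z); Fact (Mk 7 f Zer) (Pair (Suc x) v) y])].

Definition Applies (r : term * seq term) :=
  Mul (Eqn (Var 6) r.1) (foldr (fun p e => Mul (Bit (Var 7) p) e) (Cst 1) r.2).

(* [Step] is evaluated on [phi; d; k]: some rule with variables below [k] derives
   [phi] from premises in the finite set with bits [d]. *)
Definition Step :=
  Sum (Var 2) (Sum (Var 3) (Sum (Var 4) (Sum (Var 5) (Sum (Var 6) (Sum (Var 7)
    (foldr (fun r e => Add (Applies r) e) Zer rules)))))).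

(** Evaluated on [[:: s; d; 0]] with [d] the bits of stage [s]. Bounding new facts and rule
    variables by [s] keeps each stage finite. *)
Definition Next := Sum (Suc (Var 0)) (Mul (Pow2 (Var 0))
  (Bool (Add (Bit (Var 2) (Var 0)) (Call Step (Var 0) (Var 2) (Var 1))))).

Definition Stage s := Rec s Zer (Call Next (Var 0) (Var 1) Zer).

Definition stage s := eval (Stage (Var 0)) [:: s].

Lemma eval_Stage a v : eval (Stage a) v = stage (eval a v).
Proof. by []. Qed.

Definition derived s phi := bit (stage s) phi.
Definition derivable phi := exists s, derived s phi.

Definition rule n := nth (Zer, [::]) rules n.

Lemma holds_Applies r w :
  holds (Applies r) w = (nth 0 w 6 == eval r.1 w) &&
    all (fun p => bit (nth 0 w 7) (eval p w)) r.2.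
Proof.
rewrite holds_Mul holds_Eqn eval_Var; congr (_ && _).
by elim: r.2 => //= p ps <-; rewrite holds_Mul holds_Bit eval_Var.
Qed.

(** The rules mention only the six variables of [w], as inspection of each of the eleven shows. *)
Lemma rule_weaken n (f g x v y z phi d k : nat) : n < size rules ->
  let w := [:: z; y; v; x; g; f] in let w' := w ++ [:: phi; d; k] in
  eval (rule n).1 w' = eval (rule n).1 w /\
  map (eval^~ w') (rule n).2 = map (eval^~ w) (rule n).2.
Proof. by do 11?case: n => [|n] //. Qed.

Lemma holds_Step phi d k :
  holds Step [:: phi; d; k] <->
  exists n f g x v y z, let w := [:: z; y; v; x; g; f] in
    [/\ n < size rules, all (gtn k) w, phi = eval (rule n).1 w
      & all (fun p => bit d (eval p w)) (rule n).2].
Proof.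
have body w : holds (foldr (fun r e => Add (Applies r) e) Zer rules) w <->
    exists2 n, n < size rules & holds (Applies (rule n)) w.
  rewrite /rule; elim: rules => [|r rs IHrs] /=; first by split=> // -[].
  rewrite holds_Add; split.
    by case/orP=> [?|/IHrs[n ? ?]]; [exists 0 | exists n.+1].
  by case=> -[|n] ltn app; apply/orP; [left | right; apply/IHrs; exists n].
split.
  case/holds_Sum=> f lt_f /holds_Sum[g lt_g /holds_Sum[x lt_x]].
  case/holds_Sum=> v lt_v /holds_Sum[y lt_y /holds_Sum[z lt_z]].
  case/body=> n lt_n; rewrite holds_Applies => /andP[/eqP/= eq_phi prems].
  have [e1 e2] := @rule_weaken n f g x v y z phi d k lt_n.
  exists n, f, g, x, v, y, z; rewrite -[X in _ = X]e1; split=> //.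
    move: lt_f lt_g lt_x lt_v lt_y lt_z.
    by rewrite !eval_Var /= => -> -> -> -> -> ->.
  by rewrite -(all_map (eval^~ _) (bit d)) -e2 all_map.
case=> n [f [g [x [v [y [z [lt_n lt_k eq_phi prems]]]]]]].
case/and5P: lt_k => lt_z lt_y lt_v lt_x /and3P[lt_g lt_f _].
have [e1 e2] := @rule_weaken n f g x v y z phi d k lt_n.
apply/holds_Sum; exists f => //; apply/holds_Sum; exists g => //.
apply/holds_Sum; exists x => //; apply/holds_Sum; exists v => //.
apply/holds_Sum; exists y => //; apply/holds_Sum; exists z => //.
apply/body; exists n => //; rewrite holds_Applies /=.
rewrite -(all_map (eval^~ _) (bit d)) e2 e1 all_map.
by apply/andP; split; first exact/eqP.
Qed.

Lemma derived0 phi : derived 0 phi = false.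
Proof. exact: bit0. Qed.

Lemma derivedS s phi : derived s.+1 phi =
  (phi <= s) && (derived s phi || holds Step [:: phi; stage s; s]).
Proof.
rewrite -ltnS.
rewrite -(bit_sum (fun j => derived s j || holds Step [:: j; stage s; s])).
congr bit.
rewrite {1}/stage eval_Rec /= eval_Call -/(stage s) eval_Sum !evalE /=.
by apply: eq_bigr => i _; rewrite eval_Mul eval_Pow2 eval_Bool holds_Add holds_Bit.
Qed.

Lemma derived_leq s s' phi : s <= s' -> derived s phi -> derived s' phi.
Proof.
(* Facts of a stage lie below its index, so the guard of later stages never discards them. *)
have bound t psi : derived t psi -> psi < t.
  by case: t => [|t]; rewrite ?derived0 // derivedS => /andP[].
move/subnKC <-; elim: (s' - s) => [|k IHk]; first by rewrite addn0.
by rewrite addnS derivedS => /IHk phi_s; rewrite phi_s andbT ltnW // bound.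
Qed.

(** One goes back to the stage where [phi] first appears. The decrease [s' < s] is the measure for
    induction on derivations. *)
Lemma derived_inv s phi : derived s phi -> exists s' n f g x v y z,
  let w := [:: z; y; v; x; g; f] in
  [/\ s' < s, n < size rules, phi = eval (rule n).1 w
    & forall p, p \in map (eval^~ w) (rule n).2 -> derived s' p].
Proof.
elim: s => [|s IHs]; rewrite ?derived0 // derivedS => /andP[_ /orP[]].
  move=> /IHs[s' [n [f [g [x [v [y [z [lt_s]]]]]]]]].
  exists s', n, f, g, x, v, y, z.
  by split=> //; exact: ltnW.
case/holds_Step=> n [f [g [x [v [y [z [lt_n _ eq_phi prems]]]]]]].
exists s, n, f, g, x, v, y, z; split=> // p.
by move: prems; rewrite -(all_map (eval^~ _) (bit _)) => /allP; apply.
Qed.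

Lemma derivable_rule n f g x v y z : let w := [:: z; y; v; x; g; f] in
  n < size rules ->
  (forall p, p \in map (eval^~ w) (rule n).2 -> derivable p) ->
  derivable (eval (rule n).1 w).
Proof.
move=> w lt_n.
set ps := map _ _ => prems.
have [s sP] : exists s, forall p, p \in ps -> derived s p.
  elim: ps prems => [|p ps IHps] prems; first by exists 0.
  have [s1 ?] := prems p (mem_head _ _).
  have [|s2 s2P] := IHps.
    by move=> q q_ps; apply: prems; rewrite inE q_ps orbT.
  exists (maxn s1 s2) => q; rewrite inE => /predU1P[->|/s2P].
    exact: (@derived_leq s1) (leq_maxl _ _) _.
  exact: (@derived_leq s2) (leq_maxr _ _).
(* Large enough for the premises, all rule variables and the conclusion to pass the guards at
   once. *)
pose k := s + \sum_(a <- w) a + (eval (rule n).1 w) + 1.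
exists k.+1; rewrite derivedS; apply/andP; split; first by rewrite /k; lia.
apply/orP; right; apply/holds_Step; exists n, f, g, x, v, y, z; split=> //.
  rewrite /k /w !big_cons big_nil /=.
  by apply/and5P; split; try lia; rewrite andbT; lia.
rewrite -(all_map (eval^~ _) (bit _)); apply/allP => p /sP.
by apply: derived_leq; rewrite /k; lia.
Qed.

(** * Soundness and completeness of the rules *)

Fixpoint encode n (c : mu_code n) : nat :=
  match c with
  | Zero _ => mk 0 0 0
  | Succ => mk 1 0 0
  | Proj _ i => mk 2 i 0
  | Comp m _ f g =>
      mk 4 (encode f)
        (foldr (mk 3) (mk 0 0 0) [seq encode (g i) | i <- enum 'I_m])
  | Prec _ f g => mk 5 (encode f) (encode g)
  | Mu _ f => mk 6 (encode f) 0
  end.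

Definition encode_seq (v : seq nat) := foldr pair 0 v.

Definition eval_rule :=
  (eval_Fact, eval_Mk, eval_Pair, eval_Var, eval_Zer, eval_Suc).

(** The tag of the code selects the rule. Tags 2 and 5 have two rules, told apart by zero or
    successor; only tag 7 leaves a choice. *)
Lemma derived_fact_inv s t a b v y : derived s (fact (mk t a b) v y) ->
  exists2 s', s' < s &
  match t with
  | 0 => y = 0
  | 1 => exists x u, v = pair x u /\ y = x.+1
  | 2 => exists x u, v = pair x u /\
      if a is i.+1 then derived s' (fact (mk 2 i 0) u y) else y = x
  | 3 => exists y1 z, [/\ y = pair y1 z, derived s' (fact a v y1)
                        & derived s' (fact b v z)]
  | 4 => exists z, derived s' (fact b v z) /\ derived s' (fact a z y)
  | 5 => exists x u, v = pair x u /\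
      if x is k.+1 then exists z, derived s' (fact (mk 5 a b) (pair k u) z) /\
                                  derived s' (fact b (pair k (pair z u)) y)
      else derived s' (fact a u y)
  | 6 => derived s' (fact (mk 7 a 0) (pair 0 v) y)
  | 7 => exists x u, v = pair x u /\
      (y = x /\ derived s' (fact a v 0) \/ exists k,
        derived s' (fact a v k.+1) /\
        derived s' (fact (mk 7 a 0) (pair x.+1 u) y))
  | _ => False
  end.
Proof.
case/derived_inv=> s' [n [f [g [x [u [y' [z [lt_s lt_n]]]]]]]] eq_phi prems.
exists s' => //; move: eq_phi prems.
do 11?case: n lt_n => [|n] lt_n //=; rewrite !eval_rule /=;
  case/fact_inj=> /mk_inj[-> ? ?] ? ?; subst => prems.
all: have in0 p ps : p \in p :: ps := mem_head p ps.
all: have in1 p q : q \in [:: p; q] by rewrite !inE eqxx orbT.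
- by [].
- by exists x, u.
- by exists x, u.
- by exists x, u; split=> //; exact: prems.
- by exists y', z; split=> //; exact: prems.
- by exists z; split; exact: prems.
- by exists 0, u; split=> //; exact: prems.
- by exists x.+1, u; split=> //; exists z; split; exact: prems.
- exact: prems.
- by exists x, u; split=> //; left; split=> //; exact: prems.
- by exists x, u; split=> //; right; exists z; split; exact: prems.
Qed.

Ltac use_rule n f g x v y z :=
  have := @derivable_rule n f g x v y z isT;
  rewrite /= !eval_rule /=; apply=> p; rewrite ?inE;
  do ?[move=> /predU1P[->|] //]; move=> // /eqP-> //.

(** The list of codes ends with the zero code, whose value [0] is also the code of the empty
    vector. *)
Lemma derivable_foldr_mk l v ys : size ys = size l ->
  (forall k, k < size l -> derivable (fact (nth 0 l k) v (nth 0 ys k))) ->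
  derivable (fact (foldr (mk 3) (mk 0 0 0) l) v (encode_seq ys)).
Proof.
elim: l ys => [|a l IHl] [|y ys] //=.
  by move=> _ _; use_rule 0 0 0 0 v 0 0.
case=> size_ys der; have dy := der 0 isT.
have dys := IHl ys size_ys (fun k => der k.+1).
by use_rule 4 a (foldr (mk 3) (mk 0 0 0) l) 0 v y (encode_seq ys).
Qed.

Lemma derivable_foldr_mk_inv s l v z :
  derived s (fact (foldr (mk 3) (mk 0 0 0) l) v z) ->
  exists ys, [/\ z = encode_seq ys, size ys = size l &
    forall k, k < size l -> derivable (fact (nth 0 l k) v (nth 0 ys k))].
Proof.
elim: l s z => [|a l IHl] s z /= /derived_fact_inv[s' _]; first by exists [::].
case=> y [w [-> dy /IHl[ys [-> size_ys dys]]]].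
exists (y :: ys); split=> //=; first by rewrite size_ys.
by case=> [_|k /dys] //; exists s'.
Qed.

Lemma encode_complete n (c : mu_code n) (v : n.-tuple nat) y :
  mu_eval c v y -> derivable (fact (encode c) (encode_seq v) y).
Proof.
elim: c v y => {n} /=.
- by move=> n v y ->; use_rule 0 0 0 0 (encode_seq v) 0 0.
- move=> v y ->; case/tupleP: v => x v; rewrite /thead (tnth_nth 0) /=.
  by use_rule 1 0 0 x (encode_seq v) 0 0.
- move=> n i v y ->; rewrite (tnth_nth 0).
  have := ltn_ord i; rewrite -[X in _ < X](size_tuple v).
  elim: (tval v) (nat_of_ord i) => [|x u IHu] [|k] //= lt_k.
    by use_rule 2 0 0 x (encode_seq u) 0 0.
  by have := IHu _ lt_k => dk; use_rule 3 0 0 x (encode_seq u) (nth 0 u k) k.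
- move=> m n f IHf g IHg v y [w [/= gw fw]].
  set l := map _ _.
  set gs := foldr _ _ l.
  have dl : derivable (fact gs (encode_seq v) (encode_seq w)).
    apply: derivable_foldr_mk.
      by rewrite size_map size_enum_ord size_tuple.
    move=> k; rewrite size_map size_enum_ord => lt_k.
    rewrite (nth_map (Ordinal lt_k)) ?size_enum_ord //.
    rewrite (nth_ord_enum _ (Ordinal lt_k)) -(tnth_nth 0 w (Ordinal lt_k)).
    exact: IHg.
  have dw := IHf _ _ fw.
  by use_rule 5 (encode f) gs 0 (encode_seq v) y (encode_seq w).
- move=> n f IHf g IHg v; case/tupleP: v => k v y; rewrite /pf_prec theadE.
  have -> : behead_tuple [tuple of k :: v] = v by apply: val_inj.
  rewrite /=; elim: k y => [|k IHk] y /= ev.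
    have dy := IHf _ _ ev.
    by use_rule 6 (encode f) (encode g) 0 (encode_seq v) y 0.
  case: ev => z [/IHk dz /IHg /= dy].
  by use_rule 7 (encode f) (encode g) k (encode_seq v) y z.
- move=> n f IHf v y [fy lt_y].
  (* The search succeeds from every start [z <= y], by induction on [y - z]. *)
  suff dz z : z <= y ->
      derivable (fact (mk 7 (encode f) 0) (pair z (encode_seq v)) y).
    by have d0 := dz 0 isT; use_rule 8 (encode f) 0 0 (encode_seq v) y 0.
  move=> /subKn <-; elim: (y - z) => [|k IHk].
    rewrite subn0; have /= d0 := IHf _ _ fy.
    by use_rule 9 (encode f) 0 y (encode_seq v) 0 0.
  (* Once [k] reaches [y], the truncated [y - k] stays [0]. *)
  have [le_yk|lt_ky] := leqP y k.
    by move: IHk; rewrite (eqP le_yk) (eqP (leqW le_yk)).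
  have [t /IHf /= dt] : exists t, mu_eval f [tuple of y - k.+1 :: v] t.+1.
    by apply: lt_y; lia.
  have eq_k : y - k = (y - k.+1).+1 by lia.
  rewrite eq_k in IHk.
  by use_rule 10 (encode f) 0 (y - k.+1) (encode_seq v) y t.
Qed.

Lemma encode_sound n (c : mu_code n) (v : n.-tuple nat) y :
  derivable (fact (encode c) (encode_seq v) y) -> mu_eval c v y.
Proof.
elim: c v y => {n} /=.
- by move=> n v y [s /derived_fact_inv[]].
- move=> v y [s /derived_fact_inv[s' _ [x [u [+ ->]]]]].
  by case/tupleP: v => x' v /pair_inj[<- _].
- move=> n i v y [s]; rewrite (tnth_nth 0).
  have := ltn_ord i; rewrite -[X in _ < X](size_tuple v).
  elim: (tval v) (nat_of_ord i) s => [|x u IHu] [|k] //= s lt_k;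
    case/derived_fact_inv=> s' _ [x' [u' [/pair_inj[? ?]]]]; subst=> //.
  exact: IHu.
- move=> m n f IHf g IHg v y [s /derived_fact_inv[s' _ [z [dz df]]]].
  have [ys [eq_z]] := derivable_foldr_mk_inv dz.
  rewrite size_map size_enum_ord => size_ys dys.
  have sP : size ys == m by apply/eqP.
  exists (Tuple sP); split; last by apply: IHf; exists s'; rewrite /= -eq_z.
  move=> i; apply: IHg; have := dys i (ltn_ord i).
  by rewrite (nth_map i) ?size_enum_ord // nth_ord_enum (tnth_nth 0).
- move=> n f IHf g IHg v; case/tupleP: v => k v y; rewrite /pf_prec theadE.
  have -> : behead_tuple [tuple of k :: v] = v by apply: val_inj.
  rewrite /=; elim: k y => [|k IHk] y /=.
    case=> s /derived_fact_inv[s' _ [x [u [/pair_inj[<- <-]]]]] dy.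
    by apply: IHf; exists s'.
  case=> s /derived_fact_inv[s' _ [x [u [/pair_inj[<- <-]]]]] [z [dz dy]].
  by exists z; split; [apply: IHk | apply: IHg]; exists s'.
- move=> n f IHf v y [s /derived_fact_inv[s' _ ]].
  (* The search calls itself on the same code, so the induction is on the stage of derivation. *)
  suff search z :
      derived s' (fact (mk 7 (encode f) 0) (pair z (encode_seq v)) y) ->
      mu_eval f [tuple of y :: v] 0 /\
      forall t, z <= t -> t < y -> exists k, mu_eval f [tuple of t :: v] k.+1.
    by case/search=> ? lt_y; split=> // t; apply: lt_y.
  elim/ltn_ind: s' z => s' IHs z /derived_fact_inv[s'' /IHs {}IHs [x [u []]]].
  case/pair_inj=> <- <- [[-> dz]|[k [dk /IHs[fy lt_y]]]].
    by split=> [|t le_zt]; [apply: IHf; exists s'' | rewrite ltnNge le_zt].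
  split=> // t; rewrite leq_eqVlt => /predU1P[<- _|]; last exact: lt_y.
  by exists k; apply: IHf; exists s''.
Qed.

Definition Member :=
  Sum (Var 2) (Bit (Stage (Var 3)) (Fact (Var 1) (Pair (Var 2) Zer) (Var 0))).

Definition member e x s := holds Member [:: e; x; s].

Lemma memberP e x s :
  reflect (exists2 y, y < s & derived s (fact e (pair x 0) y)) (member e x s).
Proof.
have bitE y :
    holds (Bit (Stage (Var 3)) (Fact (Var 1) (Pair (Var 2) Zer) (Var 0)))
      [:: y; e; x; s] = derived s (fact e (pair x 0) y).
  by rewrite holds_Bit eval_Stage !eval_rule.
by apply: (iffP (holds_Sum _ _ _)) => -[y]; exists y; rewrite // ?bitE // -bitE.
Qed.

Lemma member_leq e x s s' : s <= s' -> member e x s -> member e x s'.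
Proof.
move=> le_s /memberP[y lt_y dy]; apply/memberP; exists y.
  exact: leq_trans lt_y le_s.
exact: derived_leq le_s dy.
Qed.

Lemma ce_member A : ce A -> exists e, forall x, A x <-> exists s, member e x s.
Proof.
case=> c ->; exists (encode c) => x; split.
  case=> y /encode_complete /= [s dy]; exists (maxn s y.+1).
  apply/memberP; exists y; rewrite ?leq_maxr //.
  exact: derived_leq (leq_maxl _ _) dy.
by case=> s /memberP[y _ dy]; exists y; apply: encode_sound; exists s.
Qed.

(** * The tree of requirements *)

(* The positive numbers form a binary tree with root [1], where [i] has the
   children [2 * i] and [2 * i + 1]. *)
Definition Anc := Sum (Suc (Var 1)) (Eqn (Shr (Var 2) (Var 0)) (Var 1)).
Definition anc a i := holds Anc [:: a; i; 0].

Lemma ancP a i : 0 < a -> reflect (exists t, i %/ 2 ^ t = a) (anc a i).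
Proof.
move=> a_gt0; apply: (iffP (holds_Sum _ _ _)) => -[t].
  by move=> _; rewrite holds_Eqn !evalE /= => /eqP; exists t.
move=> eq_a; exists t; last by rewrite holds_Eqn !evalE /= eq_a.
(* A positive quotient forces [2 ^ t <= i], hence [t <= i], within the range searched. *)
rewrite !evalE /= ltnS; apply: leq_trans (ltnW (ltn_expl t (ltnSn 1))) _.
rewrite leqNgt; apply/negP => /divn_small; rewrite eq_a => a0.
by rewrite a0 in a_gt0.
Qed.

Lemma anc_refl i : 0 < i -> anc i i.
Proof. by move=> i_gt0; apply/ancP => //; exists 0; rewrite divn1. Qed.

Lemma anc_leq a i : 0 < a -> anc a i -> a <= i.
Proof. by move=> a_gt0 /ancP[|t <-] //; exact: leq_div. Qed.

Lemma anc_double a i (b : bool) :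
  1 < a -> anc a (i.*2 + b) = (a == i.*2 + b) || anc a i.
Proof.
have half_ib : (i.*2 + b) %/ 2 = i by rewrite divn2 addnC half_bit_double.
move=> a_gt1; apply/idP/orP.
  case/ancP=> [|[|t]]; first exact: ltnW; first by rewrite divn1 => ->; left.
  rewrite expnS divnMA half_ib => eq_a; right.
  by apply/ancP; [exact: ltnW | exists t].
case=> [/eqP <-|]; first exact/anc_refl/ltnW.
case/ancP=> [|t eq_a]; first exact: ltnW.
by apply/ancP; [exact: ltnW | exists t.+1; rewrite expnS divnMA half_ib].
Qed.

(** The binary logarithm of [n], as the number of [t] with [2 ^ t.+1 <= n]. *)
Definition Level :=
  Call (Sum (Var 0) (Leq (Pow2 (Suc (Var 0))) (Var 1))).

Lemma eval_Level a b c v : eval (Level a b c) v = trunc_log 2 (eval a v).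
Proof.
rewrite eval_Call eval_Sum eval_Var /=; set n := eval a v.
have [->|n_gt0] := posnP n; first by rewrite big_ord0 trunc_log0.
under eq_bigr => t _ do rewrite eval_Leq !evalE /=.
have levelP t : (2 ^ t.+1 <= n) = (t < trunc_log 2 n).
  apply/idP/idP; first exact: trunc_log_max.
  move=> lt_t; apply: leq_trans (trunc_logP (ltnSn 1) n_gt0).
  by rewrite leq_exp2l.
under eq_bigr => t _ do rewrite levelP.
have sum_lt m l : \sum_(t < m) (t < l) = minn m l.
  elim: m => [|m IHm]; first by rewrite big_ord0 min0n.
  by rewrite big_ord_recr /= IHm; case: ltnP; lia.
rewrite sum_lt; apply/minn_idPr; apply: leq_trans (trunc_logP (ltnSn 1) n_gt0).
exact/ltnW/ltn_expl.
Qed.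

Lemma holds_Anc a b v : holds (Call Anc a b Zer) v = anc (eval a v) (eval b v).
Proof. by []. Qed.

(* The nodes that own a region: right children of nodes of odd level and left
   children of nodes of even level. *)
Definition marked a := odd (a + trunc_log 2 a).
Definition Marked a := Odd (Add a (Level a Zer Zer)).

Lemma holds_Marked a v : holds (Marked a) v = marked (eval a v).
Proof. by rewrite holds_Odd eval_Add eval_Level. Qed.

(* [threshold i / 2 ^ i.*2.+3] is [p + 2 ^- i.*2.+3], with [p] the contribution
   to the density of the marked ancestors of [i] (and of [i] itself). It separates
   [p + 2 ^- i.*2.+2], reached when the marked child of [i] is on the true path,
   from [p + 2 ^- (4 * i)], a bound for the other case as soon as [2 <= i]. *)
Definition threshold i := (\sum_(a < i.*2)
  2 ^ (i.*2.+2 - a) * [&& 1 < a, anc a i & marked a]).+1.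
Definition Threshold := Call (Suc (Sum (Add (Var 0) (Var 0))
  (Mul (Pow2 (Sub (Add (Var 1) (Add (Var 1) (Cst 2))) (Var 0)))
    (Bool (Mul (Ltn (Cst 1) (Var 0))
      (Mul (Call Anc (Var 0) (Var 1) Zer) (Marked (Var 0)))))))).

Lemma eval_Threshold a b c v : eval (Threshold a b c) v = threshold (eval a v).
Proof.
rewrite eval_Call eval_Suc eval_Sum eval_Add eval_Var /= addnn; congr _.+1.
apply: eq_bigr => k _; rewrite eval_Mul eval_Bool !holds_Mul holds_Ltn holds_Anc.
by rewrite holds_Marked !evalE /= addnA addnn addn2.
Qed.

Definition count e m s := \sum_(x < m) member e x s.
Definition Count :=
  Call (Sum (Var 1) (Bool (Call Member (Var 1) (Var 0) (Var 3)))).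

Lemma eval_Count a b c v :
  eval (Count a b c) v = count (eval a v) (eval b v) (eval c v).
Proof.
by rewrite eval_Call eval_Sum eval_Var; apply: eq_bigr => x _; rewrite eval_Bool.
Qed.

(** Levels [e.*2.+1] and [e.*2.+2] both treat the index [e], the latter for the complement. *)
Definition requirement i := (trunc_log 2 i).-1./2.

(* The ticks of node [i]: odd levels compare the density of a c.e. set with the
   threshold, even levels that of its complement, in a form free of subtraction. *)
Definition bad i m s :=
  let n := count (requirement i) m s * 2 ^ i.*2.+3 in
  if odd (trunc_log 2 i) then threshold i * m < n
  else 2 ^ i.*2.+3 * m < n + threshold i * m.
Definition Bad :=
  let L := Level (Var 0) Zer Zer in
  let w := Pow2 (Add (Var 0) (Add (Var 0) (Cst 3))) in
  let n := Mul (Count (Half (Sub L (Cst 1))) (Var 1) (Var 2)) w in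
  let t := Mul (Threshold (Var 0) Zer Zer) (Var 1) in
  Call (Add (Mul (Odd L) (Ltn t n))
            (Mul (Neg (Odd L)) (Ltn (Mul w (Var 1)) (Add n t)))).

Lemma holds_Bad a b c v :
  holds (Bad a b c) v = bad (eval a v) (eval b v) (eval c v).
Proof.
rewrite holds_Call holds_Add !holds_Mul holds_Neg holds_Odd !holds_Ltn.
rewrite !(eval_Level, eval_Add, eval_Mul, eval_Count, eval_Threshold, eval_Half).
rewrite eval_Sub eval_Level !evalE /= addnA addnn addn3 subn1 /bad.
by case: odd; rewrite ?orbF.
Qed.

Definition Exceeds := Sum (Var 2) (Mul (Leq (Var 2) (Var 0))
  (Bad (Var 1) (Var 0) (Var 3))).
Definition exceeds i k s := holds Exceeds [:: i; k; s].

Lemma exceedsP i k s :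
  reflect (exists m, [/\ m < s, k <= m & bad i m s]) (exceeds i k s).
Proof.
apply: (iffP (holds_Sum _ _ _)) => [[m lt_m]|[m [lt_m le_m bad_m]]].
  by rewrite holds_Mul holds_Leq holds_Bad => /andP[]; exists m.
by exists m => //; rewrite holds_Mul holds_Leq holds_Bad; apply/andP.
Qed.

(* [visits j k s]: by stage [s], every node at which the way from the root to [j]
   turns left has ticked beyond [k]. *)
Definition Visits := Mul (Ltn (Var 1) (Var 2)) (All (Suc (Var 0))
  (Neg (Mul (Mul (Ltn (Cst 1) (Var 0)) (Neg (Odd (Var 0))))
    (Mul (Call Anc (Var 0) (Var 1) Zer)
      (Neg (Call Exceeds (Half (Var 0)) (Var 2) (Var 3))))))).
Definition visits j k s := holds Visits [:: j; k; s].

Lemma visitsP j k s : reflect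
  (k < s /\ forall a, 1 < a -> ~~ odd a -> anc a j -> exceeds a./2 k s)
  (visits j k s).
Proof.
have bodyE a : holds (Neg (Mul (Mul (Ltn (Cst 1) (Var 0)) (Neg (Odd (Var 0))))
    (Mul (Call Anc (Var 0) (Var 1) Zer)
      (Neg (Call Exceeds (Half (Var 0)) (Var 2) (Var 3)))))) [:: a; j; k; s] =
    [&& 1 < a, ~~ odd a & anc a j] ==> exceeds a./2 k s.
  rewrite holds_Neg !holds_Mul holds_Ltn holds_Anc !holds_Neg holds_Odd.
  rewrite holds_Call !evalE /= -/(exceeds _ _ _).
  by case: (1 < a); case: (odd a); case: (anc a j) => //=; rewrite negbK.
rewrite /visits holds_Mul holds_Ltn !eval_Var.
apply: (iffP andP) => [[lt_k /holds_All all_a]|[lt_k all_a]]; split=> //.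
  move=> a a_gt1 even_a anc_aj; have := all_a a.
  rewrite !evalE bodyE a_gt1 even_a anc_aj; apply.
  by rewrite ltnS anc_leq // ltnW.
apply/holds_All => a _; rewrite bodyE; apply/implyP => /and3P[].
exact: all_a.
Qed.

(* [passes j k s]: by stage [s], the left sibling [a.-1] of some right-child
   ancestor [a] of [j] has been visited more than [k] times. *)
Definition Passes := Sum (Suc (Var 0))
  (Mul (Mul (Ltn (Cst 1) (Var 0)) (Odd (Var 0)))
    (Mul (Call Anc (Var 0) (Var 1) Zer)
      (Call Visits (Sub (Var 0) (Cst 1)) (Var 2) (Var 3)))).
Definition passes j k s := holds Passes [:: j; k; s].

Lemma passesP j k s : reflect
  (exists a, [/\ 1 < a, odd a, anc a j & visits a.-1 k s]) (passes j k s).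
Proof.
have bodyE a : holds (Mul (Mul (Ltn (Cst 1) (Var 0)) (Odd (Var 0)))
    (Mul (Call Anc (Var 0) (Var 1) Zer)
      (Call Visits (Sub (Var 0) (Cst 1)) (Var 2) (Var 3)))) [:: a; j; k; s] =
    [&& 1 < a, odd a, anc a j & visits a.-1 k s].
  rewrite !holds_Mul holds_Ltn holds_Odd holds_Anc holds_Call !evalE /= subn1.
  by rewrite -andbA.
apply: (iffP (holds_Sum _ _ _)) => [[a _]|[a [a_gt1 odd_a anc_aj vis]]].
  by rewrite bodyE => /and4P[]; exists a.
exists a; first by rewrite !evalE ltnS anc_leq // ltnW.
by rewrite bodyE; apply/and4P.
Qed.

(* The [k]-th element of the [j]-th region is [2 ^ j * (2 * k + 1) - 1], so the
   [j]-th region has density [2 ^- j.+1] and the regions [i >= j] together have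
   density [2 ^- j]. *)
Definition Region e := Sum (Suc (Var 0)) (Sum (Suc (Var 1))
  (Mul (Eqn (Suc (Var 2)) (Mul (Pow2 (Var 1)) (Suc (Add (Var 0) (Var 0)))))
    (Mul (Mul (Ltn (Cst 1) (Var 1)) (Marked (Var 1)))
      (Call e (Var 1) (Var 0) (Var 3))))).

Lemma holds_Region e x s : reflect
  (exists j k, [/\ x.+1 = 2 ^ j * k.*2.+1, 1 < j, marked j
                 & holds e [:: j; k; s]])
  (holds (Region e) [:: x; s]).
Proof.
have bodyE k j : holds
    (Mul (Eqn (Suc (Var 2)) (Mul (Pow2 (Var 1)) (Suc (Add (Var 0) (Var 0)))))
    (Mul (Mul (Ltn (Cst 1) (Var 1)) (Marked (Var 1)))
      (Call e (Var 1) (Var 0) (Var 3)))) [:: k; j; x; s] =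
    [&& x.+1 == 2 ^ j * k.*2.+1, (1 < j) && marked j & holds e [:: j; k; s]].
  rewrite holds_Mul holds_Eqn !holds_Mul holds_Ltn holds_Marked holds_Call.
  by rewrite !evalE /= addnn.
apply: (iffP (holds_Sum _ _ _)) => [[j _]|[j [k [eq_x j_gt1 mj ejk]]]].
  case/holds_Sum=> k _; rewrite bodyE => /and3P[/eqP eq_x /andP[]].
  by exists j, k.
(* As [j < 2 ^ j], both [j] and [k] are at most [x], the range of the sums. *)
have lt_j := ltn_expl j (ltnSn 1).
exists j; first by rewrite !evalE /=; nia.
apply/holds_Sum; exists k; first by rewrite !evalE /=; nia.
by rewrite bodyE; apply/and3P; split; [exact/eqP | exact/andP |].
Qed.

(** For both parities [count] stands on the larger side of the inequality, so ticks are never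
    withdrawn. *)
Lemma bad_leq i m s s' : s <= s' -> bad i m s -> bad i m s'.
Proof.
move=> le_s; have le_count e : count e m s <= count e m s'.
  apply: leq_sum => x _.
  by case: (boolP (member e x s)) => // /(member_leq le_s) ->.
have := leq_mul (le_count (requirement i)) (leqnn (2 ^ i.*2.+3)).
rewrite /bad; case: ifP => _ le_n lt_n; apply: leq_trans lt_n _ => //.
by rewrite leq_add2r.
Qed.

Lemma exceeds_leq i k k' s s' :
  k' <= k -> s <= s' -> exceeds i k s -> exceeds i k' s'.
Proof.
move=> le_k le_s /exceedsP[m [lt_m le_km bad_m]]; apply/exceedsP; exists m.
split; [exact: leq_trans lt_m le_s | exact: leq_trans le_km |].
exact: bad_leq bad_m.
Qed.

Lemma visits_leq j k s s' : s <= s' -> visits j k s -> visits j k s'.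
Proof.
move=> le_s /visitsP[lt_k vis]; apply/visitsP.
split; first exact: leq_trans le_s.
by move=> a a_gt1 even_a /(vis a a_gt1 even_a); exact: exceeds_leq.
Qed.

Lemma passes_leq j k s s' : s <= s' -> passes j k s -> passes j k s'.
Proof.
move=> le_s /passesP[a [? ? ? /(visits_leq le_s) vis]].
by apply/passesP; exists a.
Qed.

(** Each of the two predicates switches at most once, from false to true. *)
Lemma two_ce_diff (e f : term) :
  (forall x s s', s <= s' -> holds e [:: x; s] -> holds e [:: x; s']) ->
  (forall x s s', s <= s' -> holds f [:: x; s] -> holds f [:: x; s']) ->
  (forall x, ~~ holds e [:: x; 0]) ->
  two_ce [set x | (exists s, holds e [:: x; s]) /\
                  ~ (exists s, holds f [:: x; s])].
Proof.
move=> e_le f_le e0; set C := (X in two_ce X).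
exists (fun x s => holds e [:: x; s] && ~~ holds f [:: x; s]); split.
- have [c cP] := eval_representable (Bool (Mul e (Neg f))) 2.
  exists c => x s; have /= := cP [tuple x; s].
  by rewrite eval_Bool holds_Mul holds_Neg.
- by move=> x; rewrite (negbTE (e0 x)).
- move=> x.
  have [[t et]|ne] := pselect (exists s, holds e [:: x; s]); last first.
    exists 0 => // s _ /=; have -> : holds e [:: x; s] = false.
      by apply/negP => es; apply: ne; exists s.
    by apply/esym/negbTE; apply/negP; rewrite in_setE => -[].
  have [[u fu]|nf] := pselect (exists s, holds f [:: x; s]).
    exists u => // s /= le_us; rewrite (f_le x u s le_us fu) andbF.
    by apply/esym/negbTE; apply/negP; rewrite in_setE => -[_]; apply; exists u.
  exists t => // s /= le_ts; rewrite (e_le x t s le_ts et) /=.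
  have -> : holds f [:: x; s] = false by apply/negP => fs; apply: nf; exists s.
  by apply/esym/mem_set; split=> //; exists t.
move=> x; set a := fun s => holds e [:: x; s].
set b := fun s => holds f [:: x; s].
have once (h : nat -> bool) : (forall s s', s <= s' -> h s -> h s') ->
    forall s s', h s != h s.+1 -> h s' != h s'.+1 -> s = s'.
  move=> h_le s s'; wlog lt_s : s s' / s < s'.
    by move=> wl hs hs'; have [/wl->|/wl->|] // := ltngtP s s'.
  case hs : (h s); first by rewrite (h_le s s.+1).
  case hs1 : h => // _; rewrite (h_le _ s' lt_s hs1) (h_le _ s'.+1 _ hs1) //.
  exact: leqW.
have a_once := once a (e_le x); have b_once := once b (f_le x).
rewrite /= -/a -/b; set F := (X in (X #<= _)%card).
(* A stage of change goes to 0 if [a] switches there, and to 1 otherwise, when [b] must switch. *)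
pose k s : nat := a s == a s.+1.
have k_inj : {in F &, injective k}.
  move=> s s'; rewrite !in_setE /F /= -/(a s) -/(a s.+1) -/(a s') -/(a s'.+1).
  rewrite -/(b s) -/(b s.+1) -/(b s') -/(b s'.+1) /k => hs hs'.
  have [e1|n1] := eqVneq (a s); have [e2|n2] := eqVneq (a s') => // _.
    apply: b_once; [apply: contraNneq hs | apply: contraNneq hs'] => ->.
      by rewrite e1.
    by rewrite e2.
  exact: a_once.
rewrite -(card_le_eql (inj_card_eq k_inj)); apply: subset_card_le.
by move=> _ [s _ <-]; rewrite /k; case: eqP.
Qed.

(** * Visits and passes along the true path *)

Lemma visits1 k s : visits 1 k s = (k < s).
Proof.
apply/visitsP/idP => [[]|lt_k] //; split=> // a a_gt1 _ /(anc_leq (ltnW a_gt1)).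
by rewrite leqNgt a_gt1.
Qed.

Lemma passes1 k s : ~~ passes 1 k s.
Proof.
apply/passesP => -[a [a_gt1 _ /(anc_leq (ltnW a_gt1))]].
by rewrite leqNgt a_gt1.
Qed.

Lemma visits_even i k s : 0 < i ->
  visits i.*2 k s = visits i k s && exceeds i k s.
Proof.
move=> i_gt0; have anc_i a := @anc_double a i false; rewrite addn0 in anc_i.
apply/visitsP/andP => [[lt_k vis]|[/visitsP[lt_k vis] exc]]; split=> //.
- apply/visitsP; split=> // a a_gt1 even_a anc_a.
  by apply: vis; rewrite // anc_i // anc_a orbT.
- rewrite -[i]doubleK; apply: vis; rewrite ?odd_double ?anc_refl ?double_gt0 //.
  lia.
- move=> a a_gt1 even_a; rewrite anc_i // => /predU1P[->|]; last exact: vis.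
  by rewrite doubleK.
Qed.

Lemma visits_odd i k s : visits i.*2.+1 k s = visits i k s.
Proof.
have anc_i a := @anc_double a i true; rewrite addn1 in anc_i.
apply/visitsP/visitsP => -[lt_k vis]; split=> // a a_gt1 even_a anc_a.
  by apply: vis; rewrite // anc_i // anc_a orbT.
apply: vis => //; move: anc_a; rewrite anc_i // => /predU1P[eq_a|//].
by rewrite eq_a /= odd_double in even_a.
Qed.

Lemma passes_even i k s : passes i.*2 k s = passes i k s.
Proof.
have anc_i a := @anc_double a i false; rewrite addn0 in anc_i.
apply/passesP/passesP => -[a [a_gt1 odd_a anc_a vis]]; exists a; split=> //.
  move: anc_a; rewrite anc_i // => /predU1P[eq_a|//].
  by rewrite eq_a odd_double in odd_a.
by rewrite anc_i // anc_a orbT.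
Qed.

Lemma passes_odd i k s : 0 < i ->
  passes i.*2.+1 k s = passes i k s || visits i.*2 k s.
Proof.
move=> i_gt0; have anc_i a := @anc_double a i true; rewrite addn1 in anc_i.
apply/passesP/orP => [[a [a_gt1 odd_a]]|[/passesP[a [? ? anc_a ?]]|vis]].
- rewrite anc_i // => /predU1P[->|anc_a vis]; first by right.
  by left; apply/passesP; exists a.
- by exists a; split=> //; rewrite anc_i // anc_a orbT.
- exists i.*2.+1; split; rewrite //= ?odd_double ?anc_refl //; lia.
Qed.

Lemma visits_leqk j k k' s : k' <= k -> visits j k s -> visits j k' s.
Proof.
move=> le_k /visitsP[lt_k vis]; apply/visitsP.
split; first exact: leq_ltn_trans lt_k.
by move=> a a_gt1 even_a /(vis a a_gt1 even_a); exact: exceeds_leq.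
Qed.

Lemma passes_leqk j k k' s : k' <= k -> passes j k s -> passes j k' s.
Proof.
move=> le_k /passesP[a [? ? ? /(visits_leqk le_k) ?]].
by apply/passesP; exists a.
Qed.

Definition infinitary i := forall k, exists s, exceeds i k s.

Fixpoint node n :=
  if n is m.+1 then (node m).*2 + ~~ `[< infinitary (node m) >] else 1.

Lemma node_gt0 n : 0 < node n.
Proof. by elim: n => //= n; rewrite -double_gt0 addn_gt0 => ->. Qed.

(** The true path turns left only at infinitary nodes, whose ticks go beyond every [k]. *)
Lemma node_visited n k : exists s, visits (node n) k s.
Proof.
elim: n => [|n [s vis]] /=; first by exists k.+1; rewrite visits1.
case: asboolP => [/(_ k)[s' exc]|_]; last by exists s; rewrite addn1 visits_odd.
exists (maxn s s'); rewrite addn0 visits_even ?node_gt0 //.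
by rewrite (visits_leq _ vis) ?leq_maxl // (exceeds_leq _ _ exc) ?leq_maxr.
Qed.

(** Each right turn is at a node with boundedly many ticks, which bounds the visits to the left
    sibling. *)
Lemma node_passed n : exists k, forall s, ~~ passes (node n) k s.
Proof.
elim: n => [|n [k pas]] /=; first by exists 0 => s; apply: passes1.
case: asboolP => [_|/existsNP[k' /forallNP exc]].
  by exists k => s; rewrite addn0 passes_even.
exists (maxn k k') => s; rewrite addn1 passes_odd ?node_gt0 // negb_or.
rewrite visits_even ?node_gt0 // negb_and; apply/andP; split.
  by apply: contra (pas s); apply: passes_leqk; exact: leq_maxl.
apply/orP; right; apply/negP => exc_k; apply: (exc s).
by apply: exceeds_leq exc_k; rewrite ?leq_maxr.
Qed.

(** Take the last common node with the true path. If [j] branches left there, that node is finitary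
    and bounds the visits; if right, the left sibling is on the path and is visited beyond every
    [k]. *)
Lemma not_node j : 0 < j -> (forall n, node n <> j) ->
  (exists k, forall s, ~~ visits j k s) \/ (forall k, exists s, passes j k s).
Proof.
elim/ltn_ind: j => j IHj j_gt0 nj.
have [j1|j_gt1] := leqP j 1.
  by case: (nj 0); apply/eqP; rewrite eqn_leq j_gt0 j1.
have i_gt0 : 0 < j./2 by lia.
have lt_ij : j./2 < j by lia.
have [[n eq_n]|ni] := pselect (exists n, node n = j./2); last first.
  have [|[k vis]|pas] := IHj _ lt_ij i_gt0.
  - by move=> n eq_n; apply: ni; exists n.
  - left; exists k => s; rewrite -[j]odd_double_half; case: odd.
      by rewrite visits_odd.
    by rewrite visits_even // negb_and vis.
  right=> k; have [s pas_s] := pas k; exists s.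
  rewrite -[j]odd_double_half; case: odd; rewrite ?passes_even //.
  by rewrite passes_odd // pas_s.
have := nj n.+1; rewrite /= eq_n -[X in _ <> X]odd_double_half addnC.
case: asboolP => [inf|/existsNP[k /forallNP exc]]; case odd_j: (odd j) => // _.
  right=> k; have [s1 vis] := node_visited n k; have [s2 exc] := inf k.
  exists (maxn s1 s2); rewrite -[j]odd_double_half odd_j passes_odd //.
  rewrite visits_even // -eq_n (visits_leq _ vis) ?leq_maxl // eq_n.
  by rewrite (exceeds_leq _ _ exc) ?leq_maxr ?orbT.
left; exists k => s; rewrite -[j]odd_double_half odd_j visits_even // negb_and.
by apply/orP; right; apply/negP/exc.
Qed.

(** * The diagonal set and its regions *)

Definition diagonal_set : set nat := [set x |
  (exists s, holds (Region Visits) [:: x; s]) /\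
  ~ (exists s, holds (Region Passes) [:: x; s])].

Lemma two_ce_diagonal_set : two_ce diagonal_set.
Proof.
apply: two_ce_diff.
- move=> x s s' le_s /holds_Region[j [k [? ? ? vis]]].
  by apply/holds_Region; exists j, k; split=> //; exact: visits_leq vis.
- move=> x s s' le_s /holds_Region[j [k [? ? ? vis]]].
  by apply/holds_Region; exists j, k; split=> //; exact: passes_leq vis.
- by move=> x; apply/holds_Region => -[j [k [_ _ _ /visitsP[]]]].
Qed.

(** [j] is the 2-adic valuation of the product. *)
Lemma region_inj j k j' k' :
  2 ^ j * k.*2.+1 = 2 ^ j' * k'.*2.+1 -> j = j' /\ k = k'.
Proof.
have logj i m : logn 2 (2 ^ i * m.*2.+1) = i.
  rewrite lognM ?expn_gt0 // pfactorK // logn_coprime ?addn0 //.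
  by rewrite coprime2n /= odd_double.
move=> eq_jk; have eq_j : j = j' by rewrite -(logj j k) eq_jk logj.
split=> //; move: eq_jk; rewrite eq_j => /eqP; rewrite eqn_pmul2l ?expn_gt0 //.
by rewrite eqSS -!muln2 eqn_pmul2r // => /eqP.
Qed.

Definition active j := [&& 1 < j, marked j & `[< exists n, node n = j >]].

(** On the true path every element enters and those beyond the bound on passes stay. Off it, by
    [not_node], almost none enters or all are removed. *)
Lemma diagonal_set_region j : exists K, forall k, K <= k ->
  ((2 ^ j * k.*2.+1).-1 \in diagonal_set) = active j.
Proof.
have CE k : ((2 ^ j * k.*2.+1).-1 \in diagonal_set) = [&& 1 < j, marked j &
    `[< (exists s, visits j k s) /\ ~ (exists s, passes j k s) >]].
  have pos i m : (2 ^ i * m.*2.+1).-1.+1 = 2 ^ i * m.*2.+1.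
    by rewrite prednK // muln_gt0 expn_gt0.
  have regE e s : reflect [/\ 1 < j, marked j & holds e [:: j; k; s]]
      (holds (Region e) [:: (2 ^ j * k.*2.+1).-1; s]).
    apply: (iffP (holds_Region _ _ _)) => [[j' [k' []]]|[]].
      by rewrite pos => /region_inj[<- <-].
    by exists j, k; rewrite pos.
  apply/idP/and3P.
    rewrite in_setE => -[[s /regE[j_gt1 mj vis]] pas]; split=> //.
    apply/asboolP; split; first by exists s.
    by case=> t pas_t; apply: pas; exists t; apply/regE.
  case=> j_gt1 mj /asboolP[[s vis] pas]; rewrite in_setE; split.
    by exists s; apply/regE.
  by case=> t /regE[_ _ pas_t]; apply: pas; exists t.
rewrite /active; have [j_gt1|le_j] := ltnP 1 j; last first.
  by exists 0 => k _; rewrite CE ltnNge le_j.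
have [[n eq_n]|nj] := pselect (exists n, node n = j).
  have [K pas] := node_passed n; rewrite eq_n in pas.
  exists K => k le_k; rewrite CE j_gt1 /=.
  congr (_ && _); rewrite [RHS]asboolT; last by exists n.
  apply/asboolP; split; first by rewrite -eq_n; exact: node_visited.
  by case=> s /(passes_leqk le_k); apply/negP/pas.
have [n|[K vis]|pas] := not_node (ltnW j_gt1).
- by move=> eq_n; apply: nj; exists n.
- exists K => k le_k; rewrite CE j_gt1 /=; congr (_ && _).
  rewrite [RHS]asboolF //; apply/asboolP => -[[s /(visits_leqk le_k)]].
  by rewrite (negbTE (vis s)).
- exists 0 => k _; rewrite CE j_gt1 /=; congr (_ && _).
  by rewrite [RHS]asboolF //; apply/asboolP => -[_]; apply; exact: pas.
Qed.

(** * Counting in sets composed of dyadic regions *)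

Definition tally (X : pred nat) m := \sum_(x < m) X x.

Lemma tally_half X m : tally X m =
  tally (fun k => X k.*2) (uphalf m) + tally (fun k => X k.*2.+1) m./2.
Proof.
rewrite /tally; elim: m => [|m IHm]; first by rewrite !big_ord0.
rewrite big_ord_recr IHm /= uphalf_half -[in X m](odd_double_half m).
case: (odd m); rewrite /= ?add1n ?add0n.
  rewrite [in RHS](big_ord_recr m./2 (fun k : 'I_m./2.+1 => X k.*2.+1 : nat)).
  by rewrite addnA.
rewrite [in RHS](big_ord_recr m./2 (fun k : 'I_m./2.+1 => X k.*2 : nat)).
by rewrite addnAC.
Qed.

(** The first [N] binary digits of the density, read as an integer: divided by [2 ^ N] it sums
    [2 ^- j.+1] over the full regions [j < N]. *)
Definition partial (S : pred nat) N := \sum_(j < N) S j * 2 ^ (N - j.+1).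

Lemma partialS S N : partial S N.+1 = S 0 * 2 ^ N + partial (S \o succn) N.
Proof.
by rewrite /partial big_ord_recl subn1; congr (_ + _).
Qed.

Lemma partialSr S N : partial S N.+1 = 2 * partial S N + S N.
Proof.
rewrite /partial big_ord_recr /= subnn muln1; congr (_ + _).
rewrite big_distrr /=; apply: eq_bigr => j _.
by rewrite mulnCA -expnS -subSn.
Qed.

Lemma tally_cofinite X (b : bool) K : (forall k, K <= k -> X k = b) ->
  forall u, tally X u <= b * u + K /\ b * u <= tally X u + K.
Proof.
(* Charging only the exceptions below [u] makes the claim inductive. *)
move=> XK u; suff : tally X u <= b * u + minn u K /\
                    b * u <= tally X u + minn u K.
  by case; have := geq_minr u K; lia.
rewrite /tally; elim: u => [|u [IH1 IH2]]; first by rewrite big_ord0 muln0.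
rewrite big_ord_recr /=; move: (\sum_(_ < _) _) IH1 IH2 => t IH1 IH2.
have [/[dup] le_K /XK ->|lt_uK] := leqP K u.
  by case: b {XK} IH1 IH2 => /=; lia.
by case: (X u); case: b {XK} IH1 IH2 => /=; lia.
Qed.

(* The regions [j.+1] of [X] are the regions [j] of [fun y => X y.*2.+1], and the
   region [0] consists of the even numbers. *)
Lemma tally_bounds N : forall (S X : pred nat),
  (forall j, exists K, forall k, K <= k -> X (2 ^ j * k.*2.+1).-1 = S j) ->
  exists c, forall m, tally X m * 2 ^ N <= m * (partial S N).+1 + c /\
                      m * partial S N <= tally X m * 2 ^ N + c.
Proof.
elim: N => [|N IHN] S X XS.
  exists 0 => m; rewrite /partial big_ord0 !muln0 !muln1 !addn0; split=> //.
  by rewrite -[leqRHS]card_ord -sum1_card leq_sum // => x _; case: (X x).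
have [|c cP] := IHN (S \o succn) (fun y => X y.*2.+1).
  move=> j; have [K KP] := XS j.+1; exists K => k /KP /= <-; congr X.
  have := expn_gt0 2 j; rewrite expnS; nia.
have [K KP] := XS 0.
(* [2 ^ N] and [partial] absorb the rounding of the two halves of [m], the term in [K] the
   exceptional even numbers, [2 * c] the inductive error. *)
exists (2 ^ N + 2 ^ N.+1 * K + 2 * c + partial (S \o succn) N) => m.
rewrite tally_half partialS.
have even_K k : K <= k -> X k.*2 = S 0 by move=> /KP; rewrite mul1n.
have [] := tally_cofinite (X := fun k => X k.*2) even_K (uphalf m).
have [] := cP m./2; set B := tally _ m./2; set A := tally _ (uphalf m).
move: (partial _ _) => p; rewrite expnS; move: (2 ^ N) => q.
have : m <= 2 * uphalf m <= m.+1 by lia.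
have : 2 * m./2 <= m <= 2 * m./2 + 1 by lia.
move: (uphalf m) (m./2) => u h; case: (S 0) => /=; nia.
Qed.

Local Open Scope ring_scope.
Local Open Scope classical_set_scope.

(** * Existence and estimates of densities *)

Lemma rho_tally (R : realType) (X : set nat) m :
  rho R X m = (tally (fun x => x \in X) m)%:R / m%:R.
Proof.
by rewrite /rho /tally -sum1_card big_mkcond; congr (_%:R / _).
Qed.

Lemma rho_leP (R : realType) (X : set nat) (t w m : nat) :
  (0 < m)%N -> (0 < w)%N ->
  (rho R X m <= t%:R / w%:R) = (tally (fun x => x \in X) m * w <= t * m)%N.
Proof.
move=> m_gt0 w_gt0; rewrite rho_tally ler_pdivrMr ?ltr0n // mulrAC.
by rewrite ler_pdivlMr ?ltr0n // -!natrM ler_nat.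
Qed.

Lemma rho_geP (R : realType) (X : set nat) (t w m : nat) :
  (0 < m)%N -> (0 < w)%N ->
  (t%:R / w%:R <= rho R X m) = (t * m <= tally (fun x => x \in X) m * w)%N.
Proof.
move=> m_gt0 w_gt0; rewrite rho_tally ler_pdivlMr ?ltr0n // mulrAC.
by rewrite ler_pdivrMr ?ltr0n // -!natrM ler_nat.
Qed.

Section DyadicDensity.
Variables (R : realType) (S : pred nat) (X : set nat).
Hypothesis XS : forall j, exists K, forall k, (K <= k)%N ->
  ((2 ^ j * k.*2.+1).-1%N \in X) = S j.

(** In [tally_bounds] divided by [m * 2 ^ N], the constant falls below [eps] for large [m]. *)
Lemma rho_bounds N (eps : R) : 0 < eps -> \forall m \near \oo,
  (partial S N)%:R / 2 ^+ N - eps <= rho R X m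
    <= (partial S N).+1%:R / 2 ^+ N + eps.
Proof.
move=> eps_gt0; have [c cP] := tally_bounds N XS.
near=> m.
have m_gt0 : (0 < m)%N by near: m; exact: nbhs_infty_ge.
have c_le : c%:R <= eps * m%:R :> R.
  by rewrite mulrC -ler_pdivrMr //; near: m; exact: nbhs_infty_ger.
have pow_ge1 : 1 <= 2 ^+ N :> R by rewrite exprn_ege1 // ler1n.
have [] := cP m; rewrite -!(ler_nat R) !natrD !natrM !natrX rho_tally.
have mR_gt0 : 0 < m%:R :> R by rewrite ltr0n.
set T := (tally _ _)%:R; set p := (partial S N)%:R.
set p' := (partial S N).+1%:R => hi lo.
have q_gt0 : 0 < 2 ^+ N :> R by rewrite (lt_le_trans ltr01).
have c_leq : c%:R <= eps * m%:R * 2 ^+ N.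
  by apply: le_trans c_le _; rewrite ler_peMr // mulr_ge0 // ltW.
rewrite ler_pdivlMr // ler_pdivrMr //; apply/andP; split.
  rewrite -(ler_pM2r q_gt0) mulrBl mulrBl mulrAC divfK ?gt_eqF //.
  by rewrite lerBlDr mulrC (le_trans lo) // lerD2l.
rewrite -(ler_pM2r q_gt0) mulrDl mulrDl mulrAC divfK ?gt_eqF //.
by rewrite [p' * _]mulrC (le_trans hi) // lerD2l.
Unshelve. all: by end_near.
Qed.

(** The bounds differ by [2 ^- N] plus an arbitrarily small error, so the sequence is Cauchy. *)
Lemma has_density_dyadic : has_density R X.
Proof.
apply/cauchy_cvgP/cauchy_exP => eps eps_gt0.
have eps2 : 0 < eps / 2 by rewrite divr_gt0.
have [N _ /(_ N (leqnn N))/= ltN] := near_infty_natSinv_expn_lt (PosNum eps2).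
exists ((partial S N)%:R / 2 ^+ N).
apply: filterS (rho_bounds N eps2) => m /andP[lo hi].
have pS : (partial S N).+1%:R = (partial S N)%:R + 1 :> R by rewrite natr1.
by rewrite /ball /= ltr_distlC; move: lo hi ltN; rewrite pS mulrDl /=; lra.
Qed.

Lemma density_bounds N :
  (partial S N)%:R / 2 ^+ N <= density R X <= (partial S N).+1%:R / 2 ^+ N.
Proof.
apply/andP; split; apply/ler_addgt0Pr => eps eps_gt0.
  rewrite -lerBlDr; apply: limr_ge; first exact: has_density_dyadic.
  by apply: filterS (rho_bounds N eps_gt0) => m /andP[].
apply: limr_le; first exact: has_density_dyadic.
by apply: filterS (rho_bounds N eps_gt0) => m /andP[].
Qed.

End DyadicDensity.

Lemma density_ge_frequently (R : realType) (X : set nat) (q : R) :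
  has_density R X -> (forall k, exists2 m, (k <= m)%N & q <= rho R X m) ->
  q <= density R X.
Proof.
move=> cvX freq; rewrite leNgt; apply/negP => lt_dq.
have [k _ lt_q] := cvgr_lt _ cvX _ lt_dq.
by have [m /lt_q] := freq k; rewrite /= ltNge => /negP.
Qed.

Lemma density_le_frequently (R : realType) (X : set nat) (q : R) :
  has_density R X -> (forall k, exists2 m, (k <= m)%N & rho R X m <= q) ->
  density R X <= q.
Proof.
move=> cvX freq; rewrite leNgt; apply/negP => lt_qd.
have [k _ lt_q] := cvgr_gt _ cvX _ lt_qd.
by have [m /lt_q] := freq k; rewrite /= ltNge => /negP.
Qed.

(** * Diagonalization along the true path *)

Local Open Scope nat_scope.

Lemma node_bounds n : 2 ^ n <= node n < 2 ^ n.+1.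
Proof.
elim: n => //= n; rewrite [2 ^ n.+2]expnS [2 ^ n.+1]expnS; case: (~~ _); lia.
Qed.

Lemma level_node n : trunc_log 2 (node n) = n.
Proof. exact: trunc_log_eq (node_bounds n). Qed.

Lemma node_div n t : node (n + t) %/ 2 ^ t = node n.
Proof.
elim: t => [|t IHt]; first by rewrite addn0 divn1.
by rewrite addnS expnS divnMA /= divn2 addnC half_bit_double.
Qed.

Lemma leq_node n m t : n + t <= m -> 2 ^ t * node n <= node m.
Proof.
move=> le_m; have := leq_divM (node m) (2 ^ (m - n)).
have le_nm : n <= m by lia.
rewrite -{1}(subnKC le_nm) node_div mulnC; apply: leq_trans.
by rewrite leq_mul2r leq_exp2l //; apply/orP; right; lia.
Qed.

(** Later nodes of the path are at least [(node n).*2], so a smaller path node is an ancestor. *)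
Lemma node_anc n a : 0 < a < (node n).*2 ->
  anc a (node n) = `[< exists m, node m = a >].
Proof.
case/andP=> a_gt0 lt_a; apply/(ancP _ a_gt0)/asboolP => [[t eq_a]|[m eq_a]].
  have [le_tn|lt_nt] := leqP t n.
    by exists (n - t); rewrite -eq_a -(node_div _ t) subnK.
  rewrite divn_small in eq_a; first by rewrite -eq_a in a_gt0.
  have /andP[_ lt_n] := node_bounds n.
  by rewrite (leq_trans lt_n) // leq_exp2l.
exists (n - m); rewrite -eq_a -(node_div m (n - m)) subnKC //.
rewrite leqNgt; apply/negP => lt_nm.
move: lt_a; rewrite -eq_a ltnNge => /negP; apply.
by rewrite -mul2n -[X in X * _]expn1 leq_node // addn1.
Qed.

Lemma active_anc n a : a < (node n).*2 ->
  active a = [&& 1 < a, anc a (node n) & marked a].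
Proof.
move=> lt_a; rewrite /active; case: ltnP => //= a_gt1.
by rewrite node_anc ?lt_a ?andbT 1?ltnW // andbC.
Qed.

(** On the true path the marked ancestors counted by [threshold] are exactly the active regions
    below [(node n).*2]. *)
Lemma threshold_node n :
  threshold (node n) = (8 * partial active (node n).*2).+1.
Proof.
rewrite /threshold /partial big_distrr /=; congr _.+1; apply: eq_bigr => a _.
rewrite (active_anc (ltn_ord a)) mulnCA [RHS]mulnC -(expnD 2 3).
by congr (2 ^ _ * _); have := ltn_ord a; lia.
Qed.

Lemma active_next n j : (node n).*2 <= j < (node n).*2.*2 ->
  active j = marked j && (j == node n.+1).
Proof.
have := node_gt0 n; move=> i_gt0 /andP[le_j lt_j]; rewrite /active.
have -> : 1 < j by lia.
rewrite andTb; congr (_ && _).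
apply/asboolP/eqP => [[m eq_j]|->]; last by exists n.+1.
rewrite -eq_j; congr node; have [le_mn|] := leqP m n.
  by have := @leq_node m n 0; rewrite addn0 eq_j => /(_ le_mn); lia.
rewrite leq_eqVlt => /predU1P[//|lt_nm].
by have := @leq_node n m 2; rewrite addn2 eq_j => /(_ lt_nm); lia.
Qed.

Lemma threshold_density (R : realType) n : 0 < n ->
  let q := ((threshold (node n))%:R / (2 ^ (node n).*2.+3)%:R)%R in
  if marked (node n.+1) then (q < density R diagonal_set)%R
  else (density R diagonal_set < q)%R.
Proof.
move=> n_gt0; have i_gt1 : 1 < node n.
  have /andP[le_n _] := node_bounds n.
  by apply: leq_trans le_n; rewrite -[2]expn1 leq_exp2l.
rewrite threshold_node; set p := partial active _; cbv zeta.
have pow_gt0 k : (0 < (2 ^ k)%:R :> R)%R by rewrite ltr0n expn_gt0.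
case: ifP => mj.
  (* Two more digits cover both children of [node n]; one of them is 1. *)
  have /andP[+ _] := density_bounds R diagonal_set_region (node n).*2.+2.
  apply: lt_le_trans; rewrite -natrX ltr_pdivrMr // mulrAC ltr_pdivlMr //.
  rewrite -!natrM ltr_nat [2 ^ _.+3]expnS mulnA ltn_pmul2r ?expn_gt0 //.
  suff : 4 * p < partial active (node n).*2.+2 by lia.
  rewrite !partialSr -/p !(@active_next n); [|lia..].
  by move: mj => /=; case: (~~ _); rewrite /= ?addn0 ?addn1 eqxx => ->; lia.
(* Four more digits are all 0, since [i.*2.+4 <= 4 * i] for [1 < i]; the rest is at most half the
   gap. *)
have /andP[_] := density_bounds R diagonal_set_region (node n).*2.+4.
move=> /le_lt_trans; apply; rewrite -natrX ltr_pdivrMr // mulrAC ltr_pdivlMr //.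
rewrite -!natrM ltr_nat [2 ^ _.+4]expnS mulnA ltn_pmul2r ?expn_gt0 //.
suff -> : partial active (node n).*2.+4 = 16 * p by lia.
have inactive j : (node n).*2 <= j < (node n).*2.*2 -> active j = false.
  by move=> /active_next->; case: eqP => [->|_]; rewrite ?mj ?andbF.
by rewrite !partialSr -/p !inactive; lia.
Qed.

Lemma marked_node_succ n :
  marked (node n.+1) = `[< infinitary (node n) >] (+) odd n.
Proof.
rewrite /marked level_node oddD [node n.+1]/= oddD odd_double oddb /=.
by case: asbool; case: odd.
Qed.

(** * Ticks and the true counting function *)

Section Enumerated.
Variables (e : nat) (W : set nat).
Hypothesis WP : forall x, W x <-> exists s, member e x s.

Lemma count_leq_tally m s : count e m s <= tally (fun x => x \in W) m.
Proof.
apply: leq_sum => x _; case: (boolP (member e x s)) => // mem_x.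
by rewrite mem_set //; apply/WP; exists s.
Qed.

Lemma count_tally m : exists s, forall s', s <= s' ->
  count e m s' = tally (fun x => x \in W) m.
Proof.
elim: m => [|m [s IHm]]; first by exists 0 => s' _; rewrite /count /tally !big_ord0.
have [t tP] : exists t, forall s', t <= s' -> member e m s' = (m \in W).
  have [Wm|nWm] := pselect (W m).
    have /WP[t mem_m] := Wm; exists t => s' le_t.
    by rewrite mem_set // (member_leq le_t).
  exists 0 => s' _; rewrite memNset //; apply/negP => mem_m.
  by apply: nWm; apply/WP; exists s'.
exists (maxn s t) => s'; rewrite geq_max => /andP[/IHm eq_m /tP eq_t].
by rewrite /count /tally !big_ord_recr /= -/(count e m s') eq_m eq_t.
Qed.

(** The limit of [bad i m] over the stages when [i] is in charge of [W]. *)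
Definition surpasses i m :=
  let n := tally (fun x => x \in W) m * 2 ^ i.*2.+3 in
  if odd (trunc_log 2 i) then threshold i * m < n
  else 2 ^ i.*2.+3 * m < n + threshold i * m.

Lemma bad_surpasses i m s : requirement i = e -> bad i m s -> surpasses i m.
Proof.
move=> eq_e; rewrite /bad /surpasses eq_e.
have := leq_mul (count_leq_tally m s) (leqnn (2 ^ i.*2.+3)).
by case: ifP => _ le_n lt_n; apply: leq_trans lt_n _; rewrite ?leq_add2r.
Qed.

Lemma infinitary_surpasses i k : requirement i = e -> infinitary i ->
  exists2 m, k < m & surpasses i m.
Proof.
(* Starting at [k.+1] makes [m] positive, as [rho_leP] and [rho_geP] require. *)
move=> eq_e /(_ k.+1)[s /exceedsP[m [_ lt_km /(bad_surpasses eq_e)]]].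
by exists m.
Qed.

(** Once the enumeration below [m] has settled, a true excess at [m] shows as a tick. *)
Lemma finitary_surpasses i : requirement i = e -> ~ infinitary i ->
  exists k, forall m, k <= m -> ~~ surpasses i m.
Proof.
move=> eq_e /existsNP[k /forallNP exc]; exists k => m le_km.
apply/negP => sur; have [s sP] := count_tally m.
apply: (exc (maxn s m.+1)); apply/exceedsP; exists m; split=> //.
  exact: leq_maxr.
by rewrite /bad eq_e sP ?leq_maxl.
Qed.

End Enumerated.

Lemma tally_setC (A : set nat) m :
  tally (fun x => x \in A) m + tally (fun x => x \in ~` A) m = m.
Proof.
rewrite /tally -big_split /= -[RHS]card_ord -sum1_card; apply: eq_bigr => x _.
by rewrite in_setC; case: (_ \in A).
Qed.

(** Reads the subtraction-free test on the complement as a bound on [A] itself. *)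
Lemma tally_setC_leq (A : set nat) m w t :
  (w * m <= tally (fun x => x \in ~` A) m * w + t * m) =
  (tally (fun x => x \in A) m * w <= t * m).
Proof.
have : w * (tally (fun x => x \in A) m + tally (fun x => x \in ~` A) m) = w * m.
  by rewrite tally_setC.
by rewrite mulnDr => <-; rewrite ![w * _]mulnC [X in X <= _]addnC leq_add2l.
Qed.

Lemma setC_tally_leq (A : set nat) m w t :
  (tally (fun x => x \in ~` A) m * w + t * m <= w * m) =
  (t * m <= tally (fun x => x \in A) m * w).
Proof.
have : w * (tally (fun x => x \in A) m + tally (fun x => x \in ~` A) m) = w * m.
  by rewrite tally_setC.
by rewrite mulnDr => <-; rewrite ![w * _]mulnC [X in _ <= X]addnC leq_add2l.
Qed.

Theorem corollary3p7 (R : realType) :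
  exists C : set nat,
    [/\ two_ce C,
        has_density R C
      & forall A : set nat, ce A \/ coce A ->
          ~ (has_density R A /\ density R A = density R C)].
Proof.
exists diagonal_set; split; first exact: two_ce_diagonal_set.
  exact: has_density_dyadic diagonal_set_region.
move=> A ceA [cvA eq_d].
have w_gt0 i : 0 < 2 ^ i by rewrite expn_gt0.
case: ceA => [/ce_member[e eP]|/ce_member[e eP]].
  have odd_n : odd e.*2.+1 by rewrite /= odd_double.
  have req : requirement (node e.*2.+1) = e.
    by rewrite /requirement level_node doubleK.
  have := @threshold_density R e.*2.+1 isT.
  rewrite -eq_d marked_node_succ odd_n addbT; case: asboolP => [inf|fin] /=.
    (* The path turns left, away from the marked child: [density R diagonal_set] is below the
       threshold, which [A] exceeds infinitely often. *)
    rewrite ltNge => /negP; apply; apply: density_ge_frequently => // k.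
    have [m lt_km] := infinitary_surpasses eP k req inf.
    rewrite /surpasses level_node odd_n => /ltnW le_m.
    exists m; first exact: ltnW.
    by rewrite rho_geP // (leq_trans _ lt_km).
  (* The marked right child is taken, while [A] eventually stays at or below the threshold. *)
  rewrite ltNge => /negP; apply; apply: density_le_frequently => // k.
  have [k' kP] := finitary_surpasses eP req fin.
  exists (maxn k k').+1; first by rewrite leqW // leq_maxl.
  have := kP (maxn k k').+1.
  rewrite /surpasses level_node odd_n -leqNgt rho_leP //.
  by apply; rewrite leqW // leq_maxr.
(* For co-c.e. [A], [e] enumerates the complement; ticks now mean that [A] falls below the
   threshold, and the left child is marked. *)
have odd_n : odd e.*2.+2 = false by rewrite /= odd_double.
have req : requirement (node e.*2.+2) = e.
  by rewrite /requirement level_node /= uphalf_double.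
have := @threshold_density R e.*2.+2 isT.
rewrite -eq_d marked_node_succ odd_n addbF; case: asboolP => [inf|fin] /=.
  rewrite ltNge => /negP; apply; apply: density_le_frequently => // k.
  have [m lt_km] := infinitary_surpasses eP k req inf.
  rewrite /surpasses level_node odd_n => lt_m; exists m; first exact: ltnW.
  rewrite rho_leP ?(leq_trans _ lt_km) //.
  by rewrite -tally_setC_leq ltnW.
rewrite ltNge => /negP; apply; apply: density_ge_frequently => // k.
have [k' kP] := finitary_surpasses eP req fin.
exists (maxn k k').+1; first by rewrite leqW // leq_maxl.
have := kP (maxn k k').+1.
rewrite /surpasses level_node odd_n -leqNgt rho_geP //.
by rewrite leqW ?leq_maxr // -setC_tally_leq => /(_ isT).
Qed.
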